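(* Let $N\ge 1$, let $D\subseteq\{0,1\}^N$ be a finite nonempty set, and let $f:D\to\{0,1\}$ be any function. Then $$Q_2(f)\;\le\;\max_{\mu}Q_{SE}^{\mu}(f),$$ where the maximum ranges over all probability distributions $\mu$ on $D$.
   Context: Quantum query model. The input $x\in\{0,1\}^N$ is accessed through the unitary $O=O_x$ acting on basis states by $O|i,b,z\rangle=|i,b\oplus x_i,z\rangle$, with $i\in\{1,\dots,N\}$, $b\in\{0,1\}$ and $z$ a workspace of finitely many qubits. A $T$-query quantum algorithm is $A=U_TOU_{T-1}O\cdots U_1OU_0$, with each $U_j$ a fixed unitary independent of $x$; it starts in the all-zero state $|0\dots0\rangle$, and its output is obtained by measuring the rightmost bit of the final state $A|0\dots 0\rangle$. Its complexity is $T$. $P_A(x)$ denotes the probability that $A$ outputs $1$ on input $x$ (defined for every $x\in\{0,1\}^N$), and $S_A(x)$ the probability that $A$ outputs $f(x)$ on input $x\in D$. $Q_2(f)$ is the minimal number of queries of a quantum algorithm $A$ with $S_A(x)\ge \frac23$ for all $x\in D$. For a probability distribution $\mu$ on $D$, an algorithm $A$ is strongly $\frac23$-exact for $f$ with respect to $\mu$ if $\mu(\{x\in D: P_A(x)=f(x)\})\ge\frac23$ and, in addition, $P_A(x)\in\{0,1\}$ for all $x\in\{0,1\}^N$ (including $x\notin D$). $Q_{SE}^\mu(f)$ is the minimal number of queries of a strongly $\frac23$-exact algorithm for $f$ with respect to $\mu$. *)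

(* Defs.v *)
From HB Require Import structures.
From mathcomp Require Import all_boot all_order all_algebra.
From mathcomp Require Import spectral complex boolp reals.

Set Implicit Arguments.
Unset Strict Implicit.
Unset Printing Implicit Defensive.
Import Order.TTheory GRing.Theory Num.Theory.
Local Open Scope ring_scope.
Local Open Scope complex_scope.

Definition input (N : nat) : finType := {ffun 'I_N -> bool}.

(* The labels (i, b, z) of the computational basis. *)
Definition basis (N m : nat) : finType := ('I_N * bool * m.-tuple bool)%type.

Section QueryModel.
Variables (R : realType) (N : nat).

(* Operators and states on C^(basis N m) are matrices and column vectors whose
   rows and columns are numbered by enum_rank. *)
Definition operator (m : nat) := 'M[R[i]]_#|basis N m|.
Definition state (m : nat) := 'cV[R[i]]_#|basis N m|.

Definition ket (m : nat) (s : basis N m) : state m :=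
  \col_k (enum_val k == s)%:R.

(* The linear operator mapping |s> to |g s>. *)
Definition basis_map (m : nat) (g : basis N m -> basis N m) : operator m :=
  \matrix_(k, l) (enum_val k == g (enum_val l))%:R.

Definition query (m : nat) (x : input N) (s : basis N m) : basis N m :=
  let: (i, b, z) := s in (i, b (+) x i, z).

Definition oracle (m : nat) (x : input N) : operator m :=
  basis_map (query x).

(* The index register ranges over 0, ..., N-1, so its all-zero label is 0; it
   exists only when 0 < N. *)
Definition zero_label (m : nat) (N_gt0 : (0 < N)%N) : basis N m :=
  (Ordinal N_gt0, false, [tuple of nseq m false]).

(* [:: U_1; ...; U_T] is [unitaries], and U_0 is [unitary0]. *)
Record algorithm := Algorithm {
  workspace : nat;
  unitary0 : operator workspace;
  unitaries : seq (operator workspace);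
  unitary0P : unitary0 \is unitarymx;
  unitariesP : all (fun U : operator workspace => U \is unitarymx) unitaries }.

Definition queries (A : algorithm) : nat := size (unitaries A).

(* U_T O U_(T-1) O ... U_1 O U_0 *)
Definition run (A : algorithm) (x : input N) : operator (workspace A) :=
  foldl (fun V U => U *m oracle (workspace A) x *m V)
        (unitary0 A) (unitaries A).

(* The rightmost bit of (i, b, z): the last bit of z, or b if z is empty. *)
Definition rightmost (m : nat) (s : basis N m) : bool := last s.1.2 s.2.

Variable N_gt0 : (0 < N)%N.

Definition final_state (A : algorithm) (x : input N) : state (workspace A) :=
  run A x *m ket (zero_label (workspace A) N_gt0).

Definition output_prob (A : algorithm) (x : input N) (c : bool) : R :=
  \sum_(s : basis N (workspace A) | rightmost s == c)
     Normc.normc (final_state A x (enum_rank s) ord0) ^+ 2.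

Definition accept_prob (A : algorithm) (x : input N) : R :=
  output_prob A x true.

Section Measures.
Variables (D : {set input N}) (f : {x : input N | x \in D} -> bool).

Definition success_prob (A : algorithm) (x : {x : input N | x \in D}) : R :=
  output_prob A (val x) (f x).

Definition bounded_error (A : algorithm) : Prop :=
  forall x, 2%:R / 3%:R <= success_prob A x.

Record distribution := Distribution {
  mass : {x : input N | x \in D} -> R;
  mass_ge0 : forall x, 0 <= mass x;
  mass_sum1 : \sum_x mass x = 1 }.

Definition strongly_exact (mu : distribution) (A : algorithm) : Prop :=
  2%:R / 3%:R <= \sum_(x | accept_prob A (val x) == (f x)%:R) mass mu x /\
  forall x : input N, accept_prob A x = 0 \/ accept_prob A x = 1.

End Measures.

(* An algorithm that reads the whole input with N queries and computes any
   given function of it exactly: it makes the minima and the maximum below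
   well defined. *)
Section ReadAll.

Lemma basis_map_ket (m : nat) (g : basis N m -> basis N m) (s : basis N m) :
  basis_map g *m ket s = ket (g s).
Proof.
apply/colP => k; rewrite !mxE (bigD1 (enum_rank s)) //= !mxE enum_rankK eqxx.
rewrite mulr1 big1 ?addr0 // => l; rewrite -(inj_eq enum_val_inj) enum_rankK.
by rewrite !mxE => /negPf->; rewrite mulr0.
Qed.

Lemma basis_map_unitary (m : nat) (g : basis N m -> basis N m) :
  injective g -> basis_map g \is unitarymx.
Proof.
move=> g_inj; have [h gh hg] := injF_bij g_inj; apply/unitarymxP/matrixP => k l.
rewrite !mxE (bigD1 (enum_rank (h (enum_val k)))) //= !mxE enum_rankK hg eqxx.
rewrite mul1r big1 ?addr0 => [|j jk]; last first.
  rewrite !mxE [_ == _](_ : _ = false) ?mul0r //; apply: contra_neqF jk.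
  by move=> /eqP ->; rewrite gh enum_valK.
by rewrite (inj_eq enum_val_inj) eq_sym rmorph_nat.
Qed.

Definition cell (i : 'I_N) : 'I_N.+1 := widen_ord (leqnSn N) i.

Definition swap (s : basis N N.+1) : basis N N.+1 :=
  let: (i, b, z) := s in
  (i, tnth z (cell i), [tuple if j == cell i then b else tnth z j | j < N.+1]).

Definition next (s : basis N N.+1) : basis N N.+1 :=
  let: (i, b, z) := s in (ordS i, b, z).

Definition write (F : input N -> bool) (s : basis N N.+1) : basis N N.+1 :=
  let: (i, b, z) := s in
  (i, b, [tuple if j == ord_max then tnth z j (+) F [ffun k => tnth z (cell k)]
                else tnth z j | j < N.+1]).

Lemma cell_neq_max i : (cell i == ord_max) = false.
Proof. by rewrite -val_eqE /= ltn_eqF. Qed.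

Lemma swapK : involutive swap.
Proof.
move=> [[i b] z]; rewrite /swap tnth_mktuple eqxx; congr (_, _, _).
by apply: eq_from_tnth => j; rewrite !tnth_mktuple; case: eqP => // ->.
Qed.

Lemma next_inj : injective next.
Proof.
move=> [[i b] z] [[i' b'] z'] [] iE -> ->; congr (_, _, _).
exact/(can_inj (@ordSK N))/val_inj.
Qed.

Lemma writeK F : involutive (write F).
Proof.
move=> [[i b] z]; rewrite /write; congr (_, _, _).
apply: eq_from_tnth => j; rewrite !tnth_mktuple; case: eqP => // ->.
rewrite -[RHS]addbF -(addbb (F [ffun k => tnth z (cell k)])) addbA.
congr (_ (+) F _); apply/ffunP => k.
by rewrite !ffunE tnth_mktuple cell_neq_max.
Qed.

Lemma iter_read (x : input N) (t : nat) : (t <= N)%N ->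
  exists i : 'I_N, iter t (next \o swap \o query x) (zero_label N.+1 N_gt0) =
    (i, false, [tuple oapp (fun k : 'I_N => (k < t)%N && x k) false
                        (insub (val j)) | j < N.+1]) /\ val i = (t %% N)%N.
Proof.
elim: t => [_|t IH t_lt].
  exists (Ordinal N_gt0); split; last by rewrite mod0n.
  congr (_, _, _); apply: eq_from_tnth => j.
  by rewrite tnth_mktuple (tnth_nth false) nth_nseq if_same; case: insub.
have [i [itE i_t]] := IH (ltnW t_lt); rewrite iterS itE /=.
exists (ordS i); rewrite modn_small // in i_t; split; last by rewrite /= i_t.
rewrite tnth_mktuple /= insubT //= => ilt.
have -> : (i < t)%N = false by rewrite i_t ltnn.
rewrite /=; congr (_, _, _).
apply: eq_from_tnth => j; rewrite !tnth_mktuple -val_eqE /= i_t.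
case: insubP => [k _ /= <-|]; last first.
  by rewrite -leqNgt; case: eqP => // -> /(leq_trans t_lt); rewrite ltnn.
by rewrite ltnS -i_t; case: (ltngtP k i) => // /val_inj ->.
Qed.

End ReadAll.

Lemma read_all (F : input N -> bool) :
  exists2 A : algorithm, queries A = N &
    forall x c, output_prob A x c = (F x == c)%:R.
Proof.
pose G := basis_map (next \o swap).
pose H := basis_map (write F \o next \o swap).
have U1 : (1%:M : operator N.+1) \is unitarymx.
  by apply/unitarymxP; rewrite trmx1 map_mx1 mulmx1.
have UG : all (fun U : operator N.+1 => U \is unitarymx) (rcons (nseq N.-1 G) H).
  have swap_inj := inv_inj swapK; have write_inj := inv_inj (writeK F).
  rewrite all_rcons all_nseq !basis_map_unitary ?orbT //.
    exact/inj_comp/swap_inj/next_inj.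
  exact: inj_comp (inj_comp write_inj next_inj) swap_inj.
exists (Algorithm U1 UG); first by rewrite /queries size_rcons size_nseq prednK.
move=> x c; pose s := write F (iter N (next \o swap \o query x)
                                 (zero_label N.+1 N_gt0)).
have fsE : final_state (Algorithm U1 UG) x = ket s.
  rewrite /final_state /run /= foldl_rcons.
  have fold n : foldl (fun V U => U *m oracle N.+1 x *m V) 1%:M (nseq n G)
      *m ket (zero_label N.+1 N_gt0)
    = ket (iter n (next \o swap \o query x) (zero_label N.+1 N_gt0)).
    elim: n => [|n IH]; first by rewrite mul1mx.
    have -> : nseq n.+1 G = rcons (nseq n G) G by elim: n {IH} => //= n <-.
    rewrite foldl_rcons -!mulmxA IH.
    by rewrite !basis_map_ket.
  have iterN (T : Type) (h : T -> T) y : iter N h y = h (iter N.-1 h y).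
    by rewrite -iterS prednK.
  by rewrite -!mulmxA fold !basis_map_ket /s iterN.
have sF : rightmost s = F x.
  have [i [itE _]] := iter_read x (leqnn N); rewrite /s itE /rightmost.
  have lastE (z : N.+1.-tuple bool) : last false z = tnth z ord_max.
    by rewrite (last_nth false) size_tuple (tnth_nth false).
  rewrite lastE !tnth_mktuple eqxx insubN ?ltnn //=; congr (F _).
  apply/ffunP => k; rewrite ffunE tnth_mktuple /= insubT //= => kN.
  by rewrite kN; congr (x _); apply: val_inj.
rewrite /output_prob fsE -sF; case: (eqVneq (rightmost s) c) => sc; last first.
  rewrite big1 // => s' s'c; rewrite mxE enum_rankK (negPf (_ : s' != s)).
    by rewrite Normc.normc0 expr0n.
  by apply: contraNneq sc => <-.
rewrite (bigD1 s) ?sc //= mxE enum_rankK eqxx Normc.normc1 expr1n.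
rewrite big1 ?addr0 // => s' /andP[_ s's].
by rewrite mxE enum_rankK (negPf s's) Normc.normc0 expr0n.
Qed.

Section Complexities.
Variables (D : {set input N}) (f : {x : input N | x \in D} -> bool).

Lemma exact_algorithm : exists2 A : algorithm, queries A = N &
  (forall x, success_prob f A x = 1) /\
  (forall mu : distribution D, strongly_exact f mu A).
Proof.
pose F x := if insub x is Some y then f y else false.
have FE (y : {x : input N | x \in D}) : F (val y) = f y by rewrite /F valK.
have [A AN AF] := read_all F; exists A => //; split=> [x|mu].
  by rewrite /success_prob AF FE eqxx.
split=> [|x]; last by rewrite /accept_prob AF; case: (F x == true); [right|left].
rewrite (eq_bigl predT) => [|x]; last first.
  by rewrite /accept_prob AF FE eqb_id eqxx.
by rewrite mass_sum1 ler_pdivrMr ?ltr0n // mul1r ler_nat.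
Qed.

Definition bounded_error_in (T : nat) : bool :=
  `[< exists2 A : algorithm, queries A = T & bounded_error f A >].

Definition strongly_exact_in (mu : distribution D) (T : nat) : bool :=
  `[< exists2 A : algorithm, queries A = T & strongly_exact f mu A >].

Lemma bounded_error_in_ex : exists T, bounded_error_in T.
Proof.
have [A AN [As _]] := exact_algorithm; exists N; apply/asboolP; exists A => // x.
by rewrite As ler_pdivrMr ?ltr0n // mul1r ler_nat.
Qed.

Lemma strongly_exact_in_N mu : strongly_exact_in mu N.
Proof. by have [A AN [_ Ae]] := exact_algorithm; apply/asboolP; exists A. Qed.

Definition Q2 : nat := ex_minn bounded_error_in_ex.

Definition QSE (mu : distribution D) : nat :=
  ex_minn (ex_intro (strongly_exact_in mu) N (strongly_exact_in_N mu)).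

Definition QSE_value (T : nat) : bool :=
  `[< exists mu : distribution D, QSE mu = T >].

Hypothesis D_neq0 : D != set0.

Lemma QSE_value_ex : exists T, QSE_value T.
Proof.
have [x0 Dx0] := set0Pn _ D_neq0; pose y0 := Sub x0 Dx0 : {x : input N | x \in D}.
have m0 x : 0 <= (x == y0)%:R :> R by rewrite ler0n.
have m1 : \sum_(x : {x : input N | x \in D}) (x == y0)%:R = 1 :> R.
  by rewrite (bigD1 y0) //= eqxx big1 ?addr0 // => x /negPf->.
by exists (QSE (Distribution m0 m1)); apply/asboolP; exists (Distribution m0 m1).
Qed.

Lemma QSE_value_le T : QSE_value T -> (T <= N)%N.
Proof.
move=> /asboolP[mu <-]; rewrite /QSE; case: ex_minnP => T' _; apply.
exact: strongly_exact_in_N.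
Qed.

Definition max_QSE : nat := ex_maxn QSE_value_ex QSE_value_le.

End Complexities.
End QueryModel.

Arguments Q2 R {N} N_gt0 {D} f.
Arguments max_QSE R {N} N_gt0 {D} f D_neq0.

(* Main.v *)
Require Import Defs.
From mathcomp Require Import all_boot reals.
From mathcomp Require Import all_order all_algebra spectral complex boolp ring.

(** Let T be the maximum of Q_SE over all distributions.  An algorithm that is
    exact on every input computes a Boolean function, and there are finitely
    many such functions, so the algorithms with at most T queries form, up to
    behaviour, a finite set G.  Every distribution mu has a member of G that
    agrees with f with mu-probability at least 2/3; by the minimax theorem some
    distribution p on G agrees with f with probability at least 2/3 on every
    input of D.  That mixture is again a T-query quantum algorithm: after
    padding to exactly T queries, the members of G run in parallel on
    orthogonal copies of their state spaces, prepared with amplitudes sqrt p,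
    and in the end each copy writes its answer into a common output bit. *)

Set Implicit Arguments.
Unset Strict Implicit.
Unset Printing Implicit Defensive.
Import Order.TTheory GRing.Theory Num.Theory.
Local Open Scope ring_scope.

(** * Farkas' lemma and a finite minimax theorem *)

Section Minimax.
Variable R : realFieldType.

(** Induction on the generators [a i]. With [uniq s] the coefficient of the new generator [k] can be
    chosen without disturbing those of [s]. *)
Lemma farkas (X : finType) (I : eqType) (s : seq I) (a : I -> X -> R)
    (c : X -> R) : uniq s ->
  (exists2 u : I -> R, forall i, 0 <= u i &
     forall x, c x = \sum_(i <- s) u i * a i x) \/
  (exists2 y : X -> R, forall i, i \in s -> \sum_x a i x * y x <= 0 &
     0 < \sum_x c x * y x).
Proof.
elim: s a c => [|k s IH] a c /=.
  move=> _; have [/forallP c0|] := boolP [forall x, c x == 0].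
    by left; exists (fun=> 0) => // x; rewrite big_nil (eqP (c0 x)).
  rewrite negb_forall => /existsP[x cx]; right; exists c => //.
  rewrite (bigD1 x) //= ltr_pwDl //; last first.
    by apply: sumr_ge0 => y _; rewrite -expr2 sqr_ge0.
  by rewrite -expr2 lt0r sqr_ge0 sqrf_eq0 cx.
move=> /andP[ks uniq_s].
have ext (u : I -> R) t x : (forall i, 0 <= u i) ->
    \sum_(i <- k :: s) (if i == k then t else u i) * a i x =
    t * a k x + \sum_(i <- s) u i * a i x.
  move=> u0; rewrite big_cons eqxx; congr (_ + _).
  by apply: eq_big_seq => i si; case: eqP => // ik; rewrite -ik si in ks.
have [[u u0 cE]|[y ay cy]] := IH a c uniq_s.
  left; exists (fun i => if i == k then 0 else u i) => [i|x].
    by case: eqP.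
  by rewrite ext // mul0r add0r.
pose d := \sum_x a k x * y x.
have [dle|d_gt0] := leP d 0.
  by right; exists y => // i; rewrite inE => /predU1P[->|/ay].
(* Bartl's induction: [q v] is v made to vanish on y by subtracting a multiple
   of [a k]; the induction hypothesis is applied to these modified vectors. *)
pose p (v : X -> R) : R := (\sum_x v x * y x) / d.
pose q (v : X -> R) x := v x - p v * a k x.
have dotq v w : \sum_x q v x * w x =
    \sum_x v x * w x - p v * \sum_x a k x * w x.
  rewrite mulr_sumr -sumrB; apply: eq_bigr => x _.
  by rewrite /q mulrBl mulrA.
have [[u u0 cE]|[w aw cw]] := IH (fun i => q (a i)) (q c) uniq_s.
  (* [t] is nonnegative: [c] pairs positively with [y], and each [a i] with [i] in [s] pairs
     nonpositively. *)
  pose t := p c - \sum_(i <- s) u i * p (a i).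
  left; exists (fun i => if i == k then t else u i).
    move=> i; case: eqP => // _; rewrite subr_ge0.
    apply: (@le_trans _ _ 0); last by rewrite divr_ge0 ?ltW.
    rewrite big_seq sumr_le0 // => j js.
    by rewrite mulr_ge0_le0 // pmulr_lle0 ?invr_gt0 // ay.
  move=> x; rewrite ext // mulrBl.
  have := cE x; rewrite /q => /eqP; rewrite subr_eq => /eqP ->.
  rewrite addrC -addrA; congr (_ + _).
  rewrite mulr_suml addrC -sumrN -big_split; apply: eq_bigr => i _ /=.
  by rewrite mulrBr mulrA addrC.
(* Since [q (a k)] vanishes, this multiple of [y] makes the corrected [w] orthogonal to [a k]; its
   pairing with any [v] is that of [w] with [q v]. *)
right; pose b := (\sum_x a k x * w x) / d.
have dotz v : \sum_x v x * (w x - b * y x) = \sum_x q v x * w x.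
  rewrite dotq (_ : p v * _ = b * \sum_x v x * y x); last first.
    by rewrite /p /b; ring.
  rewrite mulr_sumr -sumrB; apply: eq_bigr => x _.
  by rewrite mulrBr mulrCA.
exists (fun x => w x - b * y x); last by rewrite dotz.
move=> i; rewrite dotz inE => /predU1P[->|]; last exact: aw.
by rewrite dotq /p divff ?mul1r ?subrr // gt_eqF.
Qed.

(* Farkas' lemma for the vectors (M g - c, 1) and (-e_x, 0) and the target
   (0, 1), the last coordinate being [None]. *)
Lemma minimax (X G : finType) (M : G -> X -> R) (c : R) :
  (forall w : X -> R, (forall x, 0 <= w x) ->
     exists g, \sum_x w x * c <= \sum_x w x * M g x) ->
  exists p : G -> R, [/\ forall g, 0 <= p g, \sum_g p g = 1 &
    forall x, c <= \sum_g p g * M g x].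
Proof.
move=> beats.
pose a (i : G + X) (o : option X) : R :=
  match i, o with
  | inl g, Some x => M g x - c
  | inl g, None => 1
  | inr x', Some x => - (x' == x)%:R
  | inr _, None => 0
  end.
have sum_opt (F : option X -> R) : \sum_o F o = F None + \sum_x F (Some x).
  rewrite (bigD1 None) //=; congr (_ + _).
  rewrite (reindex_omap Some id) /=; first by apply: eq_bigl => x; rewrite eqxx.
  by case.
(* In the first alternative, the coordinate [None] normalises the weights of the [inl g], and the
   weights of the [inr x] are the slack in the inequalities. *)
have [[u u0 uE]|[y ay]] := farkas a (fun o => (o == None)%:R)
    (index_enum_uniq (G + X)%type).
  have sum1 : \sum_g u (inl g) = 1.
    have := uE None; rewrite big_sumType /= mulr1n => ->.
    rewrite [X in _ = _ + X]big1 ?addr0 => [|x _]; last by rewrite mulr0.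
    by apply: eq_bigr => g _; rewrite mulr1.
  exists (fun g => u (inl g)); split=> // x.
  rewrite -subr_ge0 -[X in _ - X]mul1r -sum1 mulr_suml -sumrB.
  have := uE (Some x); rewrite big_sumType /= [X in _ + X](bigD1 x) //=.
  rewrite eqxx [X in _ + (_ + X)]big1 ?addr0 => [|x' /negPf ->]; last first.
    by rewrite oppr0 mulr0.
  move=> /eqP; rewrite mulrN1 eq_sym subr_eq0 => /eqP E.
  by under eq_bigr do rewrite -mulrBr; rewrite E.
(* In the second alternative, [y] is a nonnegative weight on [X] and [y None] is positive, so under
   this weight every [g] falls strictly short of [c], against [beats]. *)
rewrite sum_opt mul1r big1 => [|x _]; last by rewrite mul0r.
rewrite addr0 => t0.
have y0 x : 0 <= y (Some x).
  have := ay (inr x) (mem_index_enum _); rewrite sum_opt mul0r add0r.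
  rewrite (bigD1 x) //= eqxx big1 ?addr0 ?mulN1r ?oppr_le0 // => x' /negPf.
  by rewrite eq_sym => ->; rewrite oppr0 mul0r.
have [g] := beats _ y0; rewrite -subr_ge0 -sumrB leNgt => /negP[].
rewrite -(@ltrD2l _ (y None)) addr0; apply: le_lt_trans t0.
have := ay (inl g) (mem_index_enum _); rewrite sum_opt mul1r.
by congr (_ + _ <= _); apply: eq_bigr => x _; rewrite -mulrBr mulrC.
Qed.
End Minimax.

(** * Householder reflections and direct sums of unitary matrices *)

Section Unitary.
Local Open Scope sesquilinear_scope.
Variable C : numClosedFieldType.

Lemma trmxC_mul m n p (A : 'M[C]_(m, n)) (B : 'M[C]_(n, p)) :
  (A *m B)^t* = B^t* *m A^t*.
Proof. by rewrite trmx_mul map_mxM. Qed.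

Lemma trmxC_sum (I : finType) m n (A : I -> 'M[C]_(m, n)) :
  (\sum_i A i)^t* = \sum_i (A i)^t*.
Proof. by rewrite raddf_sum /= (raddf_sum (map_mx _)). Qed.

(** The reflection in the hyperplane orthogonal to [u - w] exchanges [u] and [w] when their inner
    product is real, which is what the last hypothesis says. *)
Lemma householder n (u w : 'cV[C]_n) : u^t* *m u = 1%:M -> w^t* *m w = 1%:M ->
  u^t* *m w = w^t* *m u -> exists2 H : 'M[C]_n, H \is unitarymx & H *m u = w.
Proof.
move=> uu ww uw; pose v := u - w.
have [uwE|neq] := eqVneq u w.
  exists 1%:M; last by rewrite mul1mx.
  by apply/unitarymxP; rewrite trmx1 map_mx1 mulmx1.
pose s := (u^t* *m w) ord0 ord0.
have sE : u^t* *m w = s%:M by rewrite [LHS]mx11_scalar.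
have s_real : s^* = s.
  have : (u^t* *m w)^t* = u^t* *m w by rewrite trmxC_mul trmxCK uw.
  rewrite sE tr_scalar_mx map_scalar_mx => /matrixP/(_ ord0 ord0).
  by rewrite !mxE.
have vC : v^t* = u^t* - w^t* by rewrite linearB /= map_mxB.
have vu : v^t* *m u = (1 - s)%:M by rewrite vC mulmxBl uu -uw sE raddfB.
have vv : v^t* *m v = (2 * (1 - s))%:M.
  rewrite mulmxBr vu vC mulmxBl ww sE -!raddfB; congr _%:M; ring.
(* If [s] were 1, [v] would have norm 0, contrary to [u != w]. *)
have s1 : 1 - s != 0.
  apply: contraNneq neq => s1; rewrite -subr_eq0 -/v; apply/eqP/matrixP => i j.
  rewrite [RHS]mxE; apply/eqP; rewrite -normr_eq0 -sqrf_eq0.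
  rewrite eq_le exprn_ge0 // andbT.
  have : (v^t* *m v) j j = 0 by rewrite vv s1 mulr0 !mxE mul0rn.
  rewrite mxE => <-; rewrite (bigD1 i) //= !mxE mulrC -normCK lerDl.
  by apply: sumr_ge0 => k _; rewrite !mxE mulrC -normCK exprn_ge0.
(* As [v] has squared norm [2 * (1 - s)], this is the identity minus twice the projection onto
   [v]. *)
pose H := 1%:M - (1 - s)^-1 *: (v *m v^t*).
have tC : ((1 - s)^-1)^* = (1 - s)^-1.
  by rewrite fmorphV rmorphB rmorph1 /= s_real.
have HC : H^t* = H.
  rewrite /H linearB /= map_mxB trmx1 map_mx1 linearZ /= map_mxZ.
  rewrite trmxC_mul trmxCK.
  congr (_ - _ *: _); rewrite -[RHS]tC; exact: erefl.
exists H.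
  apply/unitarymxP; rewrite HC {1}/H mulmxBl mul1mx /H mulmxBr mulmx1.
  rewrite -scalemxAr -scalemxAl mulmxA -(mulmxA v) vv mul_mx_scalar -scalemxAl.
  rewrite !scalerA mulrCA divfK // mulr_natl mulr2n scalerDl.
  by rewrite opprB addrK subrK.
rewrite mulmxBl mul1mx -scalemxAl -mulmxA vu mul_mx_scalar scalerA mulVf //.
by rewrite scale1r /v opprB addrCA subrr addr0.
Qed.

Section Block.
Variables (I : finType) (n : nat) (d : I -> nat) (J : forall i, 'M[C]_(n, d i)).
Hypothesis J_isometry : forall i, (J i)^t* *m J i = 1%:M.
Hypothesis J_orthogonal : forall i j, i != j -> (J i)^t* *m J j = 0.

(* U i on the range of J i, and the identity on the orthogonal complement. *)
Definition dirsum_mx (U : forall i, 'M[C]_(d i)) : 'M[C]_n :=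
  \sum_i J i *m U i *m (J i)^t* + (1%:M - \sum_i J i *m (J i)^t*).

Lemma mul_sum_adjoint i (U : forall i, 'M[C]_(d i)) :
  (\sum_j J j *m U j *m (J j)^t*) *m J i = J i *m U i.
Proof.
rewrite mulmx_suml (bigD1 i) //= -mulmxA J_isometry mulmx1.
rewrite big1 ?addr0 // => j ji.
by rewrite -mulmxA J_orthogonal // mulmx0.
Qed.

Lemma dirsum_mxJ U i : dirsum_mx U *m J i = J i *m U i.
Proof.
rewrite mulmxDl mul_sum_adjoint mulmxBl mul1mx.
rewrite (eq_bigr (fun j => J j *m 1%:M *m (J j)^t*)) => [|j _]; last first.
  by rewrite mulmx1.
by rewrite (mul_sum_adjoint i (fun=> 1%:M)) mulmx1 subrr addr0.
Qed.

Lemma dirsum_mxM U V :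
  dirsum_mx U *m dirsum_mx V = dirsum_mx (fun i => U i *m V i).
Proof.
rewrite [dirsum_mx V]/dirsum_mx mulmxDr mulmxBr mulmx1 !mulmx_sumr.
congr (_ + _).
  by apply: eq_bigr => i _; rewrite !mulmxA dirsum_mxJ.
rewrite (eq_bigr (fun i => J i *m U i *m (J i)^t*)) => [|i _].
  by rewrite /dirsum_mx addrC addKr.
by rewrite mulmxA dirsum_mxJ.
Qed.

Lemma dirsum_mx1 : dirsum_mx (fun=> 1%:M) = 1%:M.
Proof.
rewrite /dirsum_mx (eq_bigr (fun j => J j *m (J j)^t*)) => [|j _].
  by rewrite addrC subrK.
by rewrite mulmx1.
Qed.

Lemma dirsum_mxC U : (dirsum_mx U)^t* = dirsum_mx (fun i => (U i)^t*).
Proof.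
rewrite /dirsum_mx raddfD raddfB /= map_mxD map_mxB trmx1 map_mx1 !trmxC_sum.
congr (_ + (_ - _)); apply: eq_bigr => i _.
  by rewrite !trmxC_mul trmxCK mulmxA.
by rewrite trmxC_mul trmxCK.
Qed.

Lemma dirsum_mx_unitary U : (forall i, U i \is unitarymx) ->
  dirsum_mx U \is unitarymx.
Proof.
move=> Uu; apply/unitarymxP; rewrite dirsum_mxC dirsum_mxM -[RHS]dirsum_mx1.
rewrite /dirsum_mx; congr (_ + _); apply: eq_bigr => i _.
by rewrite (unitarymxP (Uu i)).
Qed.
End Block.
End Unitary.

(** * States, embeddings of basis labels and measurement weights *)

Section Quantum.
Local Open Scope complex_scope.
Local Open Scope sesquilinear_scope.
Variables (R : realType) (N : nat).
Local Notation state := (@state R N).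
Local Notation operator := (@operator R N).
Local Notation ket := (@ket R N _).

Lemma conj_real_complex (r : R) : Num.conj r%:C = r%:C.
Proof. by apply: conj_Creal; apply/complex_realP; exists r. Qed.

Lemma normc_sqr (a : R[i]) : (Normc.normc a ^+ 2)%:C = a * Num.conj a.
Proof. by rewrite -normCK rmorphXn. Qed.

Lemma normc_real_complex (r : R) : Normc.normc r%:C ^+ 2 = r ^+ 2.
Proof.
by apply: complexI; rewrite normc_sqr conj_real_complex -rmorphM.
Qed.

Lemma ket_adjointE m (s : basis N m) n (v : 'M[R[i]]_(_, n)) :
  (ket s)^t* *m v = row (enum_rank s) v.
Proof.
apply/matrixP => i j; rewrite !mxE (bigD1 (enum_rank s)) //= !mxE.
rewrite enum_rankK eqxx conjC1 mul1r big1 ?addr0 // => k.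
rewrite -(inj_eq enum_val_inj) enum_rankK => /negPf ks.
by rewrite !mxE ks conjC0 mul0r.
Qed.

Lemma ket_orthonormal m (s t : basis N m) :
  (ket s)^t* *m ket t = ((s == t)%:R)%:M.
Proof.
rewrite ket_adjointE; apply/matrixP => i j.
by rewrite !ord1 !mxE enum_rankK eqxx.
Qed.

(** The amplitudes are real, hence so is the inner product with [ket s0], as [householder]
    requires. *)
Lemma state_preparation m (I : finType) (s : I -> basis N m) (p : I -> R)
    (s0 : basis N m) :
  injective s -> (forall i, 0 <= p i) -> \sum_i p i = 1 ->
  exists2 H : operator m, H \is unitarymx &
    H *m ket s0 = \sum_i (Num.sqrt (p i))%:C *: ket (s i).
Proof.
move=> s_inj p0 p1; set w := \sum_i _.
have wC : w^t* = \sum_i (Num.sqrt (p i))%:C *: (ket (s i))^t*.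
  rewrite trmxC_sum; apply: eq_bigr => i _.
  by rewrite linearZ /= map_mxZ; congr (_ *: _); apply: conj_real_complex.
apply: householder.
- by rewrite ket_orthonormal eqxx.
- rewrite wC mulmx_suml (eq_bigr (fun i => (p i)%:C%:M)) => [|i _].
    by rewrite -raddf_sum -rmorph_sum p1.
  rewrite mulmx_sumr (bigD1 i) //= -scalemxAl -scalemxAr ket_orthonormal eqxx.
  rewrite scalerA -rmorphM -expr2 sqr_sqrtr // scale_scalar_mx mulr1.
  rewrite big1 ?addr0 // => j ji; rewrite -scalemxAl -scalemxAr ket_orthonormal.
  by rewrite inj_eq // eq_sym (negPf ji) raddf0 !scaler0.
rewrite wC mulmx_suml mulmx_sumr; apply: eq_bigr => i _.
by rewrite -scalemxAl -scalemxAr !ket_orthonormal eq_sym.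
Qed.

(** A rectangular [basis_map] between different workspaces; it is an isometry when [g] is
    injective. *)
Definition embed m m' (g : basis N m -> basis N m') :
    'M[R[i]]_(#|basis N m'|, #|basis N m|) :=
  \matrix_(k, l) (enum_val k == g (enum_val l))%:R.

Lemma embedM m1 m2 m3
    (g : basis N m2 -> basis N m3) (h : basis N m1 -> basis N m2) :
  embed g *m embed h = embed (g \o h).
Proof.
apply/matrixP => k l; rewrite !mxE (bigD1 (enum_rank (h (enum_val l)))) //=.
rewrite !mxE enum_rankK eqxx mulr1 big1 ?addr0 // => j.
by rewrite -(inj_eq enum_val_inj) enum_rankK !mxE => /negPf ->; rewrite mulr0.
Qed.

Lemma embed_ket m m' (g : basis N m -> basis N m') (s : basis N m) :
  embed g *m ket s = ket (g s).
Proof.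
apply/colP => k; rewrite !mxE (bigD1 (enum_rank s)) //= !mxE enum_rankK eqxx.
rewrite mulr1 big1 ?addr0 // => l; rewrite -(inj_eq enum_val_inj) enum_rankK.
by rewrite !mxE => /negPf->; rewrite mulr0.
Qed.

Lemma embed_adjointM m1 m2 m
    (g : basis N m1 -> basis N m) (h : basis N m2 -> basis N m) :
  (embed g)^t* *m embed h =
  \matrix_(k, l) (g (enum_val k) == h (enum_val l))%:R.
Proof.
apply/matrixP => k l; rewrite !mxE (bigD1 (enum_rank (h (enum_val l)))) //=.
rewrite !mxE enum_rankK eqxx mulr1 rmorph_nat eq_sym big1 ?addr0 // => j.
by rewrite -(inj_eq enum_val_inj) enum_rankK !mxE => /negPf ->; rewrite mulr0.
Qed.

Lemma oracle_embed m m' (g : basis N m -> basis N m') x :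
  (forall s, query x (g s) = g (query x s)) ->
  oracle R m' x *m embed g = embed g *m oracle R m x.
Proof.
(* [oracle] is convertible to [embed (query x)], so [embedM] applies to both sides. *)
move=> gx; rewrite [LHS]embedM [RHS]embedM.
by apply/matrixP => k l; rewrite !mxE /= gx.
Qed.

Lemma oracle_unitary m (x : input N) : oracle R m x \is unitarymx.
Proof.
apply: basis_map_unitary; apply: can_inj (query x) _ => -[[i b] z] /=.
by rewrite -addbA addbb addbF.
Qed.

(** This is [run] detached from the record, so that inductions can vary the first operator and the
    list. *)
Definition evolve m (x : input N) (V0 : operator m) (Us : seq (operator m)) :=
  foldl (fun V U => U *m oracle R m x *m V) V0 Us.

Lemma evolve_unitary m x (V0 : operator m) Us : V0 \is unitarymx ->
  all (fun U : operator m => U \is unitarymx) Us ->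
  evolve x V0 Us \is unitarymx.
Proof.
elim: Us V0 => [|U Us IH] V0 V0u; first by move=> _; exact: V0u.
move=> /andP[Uu Usu]; apply: IH Usu; apply: mul_unitarymx V0u.
by apply: mul_unitarymx; [exact: Uu | exact: oracle_unitary].
Qed.

(** [V] is merged into the last unitary, or into [V0] when there is no query, so a final gate costs
    no query. *)
Lemma evolve_postcompose m (V0 : operator m) Us (V : operator m) :
  V0 \is unitarymx -> all (fun U : operator m => U \is unitarymx) Us ->
  V \is unitarymx ->
  exists V0' Us', [/\ V0' \is unitarymx,
    all (fun U : operator m => U \is unitarymx) Us', size Us' = size Us &
    forall x, evolve x V0' Us' = V *m evolve x V0 Us].
Proof.
move=> V0u Usu Vu; case/lastP: Us Usu => [_|Us U].
  exists (V *m V0), [::].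
  by split; [exact: mul_unitarymx Vu V0u | exact: isT | | move=> x].
rewrite all_rcons => /andP[Uu Usu].
exists V0, (rcons Us (V *m U)); split.
- exact: V0u.
- rewrite all_rcons; apply/andP.
  by split; [apply: mul_unitarymx Vu _; exact: Uu | exact: Usu].
- by rewrite !size_rcons.
by move=> x; rewrite /evolve !foldl_rcons !mulmxA.
Qed.

Definition weight m (v : state m) (c : bool) : R :=
  \sum_(s | rightmost s == c) Normc.normc (v (enum_rank s) ord0) ^+ 2.

Lemma weight_total m (v : state m) : v^t* *m v = 1%:M ->
  weight v true + weight v false = 1.
Proof.
move=> /matrixP/(_ ord0 ord0); rewrite !mxE /= => v1; apply: complexI.
rewrite -[RHS]v1 /weight.
rewrite [X in _ + X](eq_bigl (fun s => ~~ (rightmost s == true))).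
  rewrite -(bigID (fun s => rightmost s == true) xpredT) rmorph_sum.
  rewrite (reindex (@enum_val _ (mem (basis N m)))) /=; last first.
    exact/onW_bij/enum_val_bij.
  by apply: eq_bigr => k _; rewrite normc_sqr enum_valK !mxE mulrC.
by move=> s; case: rightmost.
Qed.

(** By injectivity at most one summand is nonzero, so the squared modulus passes through the sum. *)
Lemma normc_sum_inj (I : finType) (Y : eqType) (g : I -> Y) (v : I -> R[i]) y :
  injective g ->
  Normc.normc (\sum_i (y == g i)%:R * v i) ^+ 2 =
  \sum_i (y == g i)%:R * Normc.normc (v i) ^+ 2.
Proof.
move=> g_inj; have [/existsP[i /eqP ->]|] := boolP [exists i, y == g i].
  rewrite [in LHS](bigD1 i) // [RHS](bigD1 i) //= eqxx !mul1r.
  rewrite !big1 ?addr0 // => j ji;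
    by rewrite inj_eq // eq_sym (negPf ji) mul0r.
rewrite negb_exists => /forallP gy.
rewrite !big1 => [|i _|i _]; last 2 first.
- by rewrite (negPf (gy i)) mul0r.
- by rewrite (negPf (gy i)) mul0r.
by rewrite Normc.normc0 expr0n.
Qed.

(* Isometries with orthogonal ranges that preserve the output bit: the cross
   terms vanish. *)
Lemma weight_mixture m (G : finType) (d : G -> nat)
    (g : forall i, basis N (d i) -> basis N m)
    (a : G -> R) (v : forall i, state (d i)) c :
  injective (fun s : {i & basis N (d i)} => g (tag s) (tagged s)) ->
  (forall i s, rightmost (g i s) = rightmost s) ->
  weight (\sum_i (a i)%:C *: (embed (g i) *m v i)) c =
  \sum_i a i ^+ 2 * weight (v i) c.
Proof.
move=> g_inj g_out; pose h (s : {i & basis N (d i)}) := g (tag s) (tagged s).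
pose n (s : {i & basis N (d i)}) :=
  (a (tag s))%:C * v (tag s) (enum_rank (tagged s)) ord0.
have entry t : (\sum_i (a i)%:C *: (embed (g i) *m v i)) (enum_rank t) ord0 =
    \sum_s (t == h s)%:R * n s.
  rewrite summxE; pose F i (s : basis N (d i)) := (t == g i s)%:R *
    ((a i)%:C * v i (enum_rank s) ord0).
  rewrite -(sig_big_dep xpredT (fun _ => xpredT) F); apply: eq_bigr => i _.
  rewrite !mxE mulr_sumr (reindex enum_rank) /=; last first.
    exact/onW_bij/enum_rank_bij.
  by apply: eq_bigr => s _; rewrite /F !mxE !enum_rankK mulrCA.
rewrite /weight.
under eq_bigr do rewrite entry normc_sum_inj //.
rewrite exchange_big /=.
pose F i (s : basis N (d i)) := (rightmost s == c)%:R *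
  (a i ^+ 2 * Normc.normc (v i (enum_rank s) ord0) ^+ 2).
transitivity (\sum_(s : {i & basis N (d i)}) F (tag s) (tagged s)).
  apply: eq_bigr => s _; rewrite big_mkcond (bigD1 (h s)) //= eqxx.
  rewrite big1 ?addr0 => [|t /negPf ->]; last by rewrite mul0r if_same.
  rewrite /F /h g_out; case: eqP => _; rewrite ?mul0r // !mul1r.
  by rewrite Normc.normcM exprMn normc_real_complex.
rewrite -(sig_big_dep xpredT (fun _ => xpredT) F); apply: eq_bigr => i _.
rewrite mulr_sumr [RHS]big_mkcond; apply: eq_bigr => s _.
by rewrite /F; case: eqP => _; rewrite ?mul1r ?mul0r.
Qed.

(** * Total probability and padding with idle queries *)

Variable N_gt0 : (0 < N)%N.

Lemma output_probE (A : algorithm R N) x c : output_prob N_gt0 A x c =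
  weight (evolve x (unitary0 A) (unitaries A) *m
          ket (zero_label (workspace A) N_gt0)) c.
Proof. by []. Qed.

Lemma output_prob_total (A : algorithm R N) x :
  output_prob N_gt0 A x true + output_prob N_gt0 A x false = 1.
Proof.
rewrite !output_probE weight_total // trmxC_mul mulmxA.
have /unitarymxP/mulmx1C Au := evolve_unitary x (unitary0P A) (unitariesP A).
by rewrite -(mulmxA ((ket _)^t*)) Au mulmx1 ket_orthonormal eqxx.
Qed.

(* The oracle fixes |0>(|0> + |1>)|0...0>, so that state can absorb an idle
   query. *)
Lemma pad_query (A : algorithm R N) :
  exists2 B : algorithm R N, queries B = (queries A).+1 &
    forall x c, output_prob N_gt0 B x c = output_prob N_gt0 A x c.
Proof.
pose m := workspace A; pose z0 := zero_label m N_gt0.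
pose plus (b : bool) : basis N m := (z0.1.1, b, z0.2).
have [|||H Hu HE] := @state_preparation m bool plus (fun=> 2^-1) z0.
- by move=> b b' [].
- by move=> _; rewrite invr_ge0 ler0n.
- by rewrite big_bool [RHS]splitr mul1r.
(* The adjoint of [H] brings the state back to [ket z0] after the idle query, before [unitary0 A]
   acts. *)
have VU : all (fun U : operator m => U \is unitarymx)
    ((unitary0 A *m H^t*) :: unitaries A).
  by rewrite /= unitariesP mul_unitarymx ?trmxC_unitary ?unitary0P.
exists (Algorithm Hu VU) => [|x c]; first exact: erefl.
rewrite !output_probE /=.
congr (weight _ c).
suff foldE us V V' : V *m ket z0 = V' *m ket z0 ->
    evolve x V us *m ket z0 = evolve x V' us *m ket z0.
  apply: foldE; rewrite -!mulmxA.
  have -> : oracle R m x *m (H *m ket z0) = H *m ket z0.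
    (* The query permutes the two terms of the superposition, which have equal amplitudes. *)
    rewrite HE mulmx_sumr [RHS](reindex_inj (@addIb (x z0.1.1))).
    by apply: eq_bigr => b _; rewrite -scalemxAr basis_map_ket.
  by rewrite (mulmxA _ H) (mulmx1C (unitarymxP Hu)) mul1mx.
elim: us V V' => [|U us IH] V V' //= VV'; apply: IH.
by rewrite -!mulmxA VV'.
Qed.

Lemma pad_queries (A : algorithm R N) T : (queries A <= T)%N ->
  exists2 B : algorithm R N, queries B = T &
    forall x c, output_prob N_gt0 B x c = output_prob N_gt0 A x c.
Proof.
elim: T => [|T IH]; first by rewrite leqn0 => /eqP; exists A.
rewrite leq_eqVlt => /predU1P[|/IH [B BT BE]]; first by exists A.
have [B' B'T B'E] := pad_query B; exists B'; first by rewrite B'T BT.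
by move=> x c; rewrite B'E.
Qed.

(** * Probabilistic mixtures of algorithms *)

Definition onehot (Z : finType) (z : Z) : #|Z|.-tuple bool :=
  [tuple k == enum_rank z | k < #|Z|].

Lemma onehot_inj (Z : finType) : injective (@onehot Z).
Proof.
move=> z z' /(congr1 (fun t => tnth t (enum_rank z))).
by rewrite !tnth_mktuple eqxx => /esym/eqP/enum_rank_inj.
Qed.

(** A flip of the last bit controlled by all other registers. As [F] does not see the flipped bit,
    this is an involution, hence a permutation of the basis. *)
Definition toggle K (F : 'I_N -> bool -> K.-tuple bool -> bool)
    (s : basis N K.+1) : basis N K.+1 :=
  let: (i, b, t) := s in
  let w := [tuple of belast (thead t) (behead t)] in
  (i, b, [tuple of rcons w (last false t (+) F i b w)]).

Lemma toggle_rcons K F i b (w : K.-tuple bool) c :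
  toggle F (i, b, [tuple of rcons w c]) =
  (i, b, [tuple of rcons w (c (+) F i b w)]).
Proof.
rewrite /toggle last_rcons.
have -> : [tuple of belast (thead [tuple of rcons w c])
                           (behead (rcons w c))] = w.
  apply: val_inj => /=; rewrite /thead (tnth_nth false) /=.
  by case: w => -[|a w] //= _; rewrite belast_rcons.
by [].
Qed.

Lemma tuple_rconsE K (t : K.+1.-tuple bool) :
  exists (w : K.-tuple bool) c, t = [tuple of rcons w c].
Proof.
case/tupleP: t => a t; exists [tuple of belast a t], (last a t).
by apply: val_inj; rewrite /= lastI.
Qed.

Lemma toggleK K F : involutive (@toggle K F).
Proof.
move=> [[i b] t]; have [w [c ->]] := tuple_rconsE t.
by rewrite (toggle_rcons F i b w c) toggle_rcons -addbA addbb addbF.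
Qed.

Lemma mixture (G : finType) (A : G -> algorithm R N) (T : nat) (p : G -> R) :
  (forall g, queries (A g) = T) -> (forall g, 0 <= p g) -> \sum_g p g = 1 ->
  exists2 B : algorithm R N, queries B = T &
    forall x c, output_prob N_gt0 B x c =
      \sum_g p g * output_prob N_gt0 (A g) x c.
Proof.
move=> AT p0 p1; pose d g := workspace (A g).
pose S : finType := {g & basis N (d g)}.
pose Z : finType := {g & (d g).-tuple bool}; pose K := #|Z|.
pose tagS g (s : basis N (d g)) : S := Tagged (fun g => basis N (d g)) s.
pose tagZ g (z : (d g).-tuple bool) : Z :=
  Tagged (fun g => (d g).-tuple bool) z.
pose enc (r : forall g, basis N (d g) -> bool) g (s : basis N (d g)) :
    basis N K.+1 :=
  (s.1.1, s.1.2, [tuple of rcons (onehot (tagZ g s.2)) (r g s)]).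
have enc_inj r : injective (fun s : S => enc r (tag s) (tagged s)).
  move=> [g [[i b] z]] [g' [[i' b'] z']] [] -> -> /rcons_inj[] zE _.
  have : tagZ g z = tagZ g' z' by apply/onehot_inj/val_inj.
  (* [E] restores the index and query bit, turning equality of tagged workspaces into equality of
     tagged basis states. *)
  pose E (zz : Z) : S := tagS (tag zz) (i', b', tagged zz).
  by move=> /(congr1 E).
pose enc0 := enc (fun _ _ => false).
have enc0_inj g g' s s' : enc0 g s = enc0 g' s' -> tagS g s = tagS g' s'.
  exact: (enc_inj _ (tagS g s) (tagS g' s')).
pose J g := embed (enc0 g).
have J_iso g : (J g)^t* *m J g = 1%:M.
  rewrite embed_adjointM; apply/matrixP => k l; rewrite !mxE.
  rewrite -(inj_eq enum_val_inj); congr ((nat_of_bool _)%:R).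
  by apply/eqP/eqP => [/enc0_inj/eqP|-> //]; rewrite eq_Tagged => /eqP.
have J_orth g g' : g != g' -> (J g)^t* *m J g' = 0.
  move=> gg'; rewrite embed_adjointM; apply/matrixP => k l; rewrite !mxE.
  by case: eqP => // /enc0_inj/(congr1 tag)/= /eqP; rewrite (negPf gg').
(* The identity as default makes [U g j] unitary also for [j] beyond the end of the list. *)
pose U g j : operator (d g) := nth 1%:M (unitaries (A g)) j.
have Uu g j : U g j \is unitarymx.
  have [jlt|jge] := ltnP j (size (unitaries (A g))).
    exact: (allP (unitariesP (A g))) (mem_nth _ jlt).
  rewrite /U nth_default //; apply/unitarymxP.
  by rewrite trmx1 map_mx1 mulmx1.
pose W j := dirsum_mx J (fun g => U g j).
have Wu j : W j \is unitarymx.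
  exact: (dirsum_mx_unitary J_iso J_orth (fun g => Uu g j)).
pose z0 := zero_label K.+1 N_gt0.
pose s0 g := zero_label (d g) N_gt0.
have s_inj : injective (fun g => enc0 g (s0 g)).
  by move=> g g' /enc0_inj/(congr1 tag).
have [P Pu PE] := state_preparation z0 s_inj p0 p1.
pose V0 := dirsum_mx J (fun g => unitary0 (A g)) *m P.
have V0u : V0 \is unitarymx.
  apply: mul_unitarymx Pu.
  exact: (dirsum_mx_unitary J_iso J_orth (fun g => unitary0P (A g))).
have Wsu : all (fun U : operator K.+1 => U \is unitarymx) (mkseq W T).
  by apply/allP => _ /mapP[j _ ->]; exact: Wu.
(* The copies never mix: each evolves as its own algorithm and keeps its initial amplitude. *)
have evolveE n x : evolve x V0 (mkseq W n) *m ket z0 =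
    \sum_g (Num.sqrt (p g))%:C *: (J g *m
      (evolve x (unitary0 (A g)) (mkseq (U g) n) *m ket (s0 g))).
  elim: n => [|n IH].
    rewrite /V0 /= -mulmxA PE mulmx_sumr; apply: eq_bigr => g _.
    by rewrite -scalemxAr -embed_ket mulmxA (dirsum_mxJ J_iso J_orth) -mulmxA.
  rewrite !mkseqS /evolve foldl_rcons -!mulmxA [foldl _ _ _ *m _]IH.
  rewrite !mulmx_sumr; apply: eq_bigr => g _.
  rewrite mkseqS foldl_rcons -!scalemxAr; congr (_ *: _).
  rewrite (mulmxA (oracle _ _ _) (J g)) oracle_embed; last by move=> [[]].
  by rewrite -mulmxA (mulmxA (W n)) (dirsum_mxJ J_iso J_orth) !mulmxA.
pose F (i : 'I_N) (b : bool) (w : K.-tuple bool) :=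
  [exists zz : Z, (w == onehot zz) &&
                  @rightmost N (d (tag zz)) (i, b, tagged zz)].
have toggleE g s : toggle F (enc0 g s) = enc (fun g => @rightmost N (d g)) g s.
  case: s => [[i b] z]; rewrite [LHS]toggle_rcons addFb.
  suff -> : F i b (onehot (tagZ g z)) = rightmost (i, b, z) by [].
  apply/existsP/idP => [[zz]|rz]; last by exists (tagZ g z); rewrite eqxx.
  by case/andP=> /eqP/onehot_inj <-.
have [V0' [Us [V0'u Usu sizeUs UsE]]] := evolve_postcompose V0u Wsu
  (basis_map_unitary R (inv_inj (toggleK F))).
exists (Algorithm V0'u Usu); first by rewrite /queries sizeUs size_mkseq.
move=> x c; rewrite output_probE /= UsE -mulmxA evolveE mulmx_sumr.
(* The final [toggle] puts each copy's answer into the reserved bit; the resulting embeddings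
   preserve [rightmost], as [weight_mixture] requires. *)
rewrite (eq_bigr (fun g => (Num.sqrt (p g))%:C *:
  (embed (enc (fun g => @rightmost N (d g)) g) *m
   (evolve x (unitary0 (A g)) (mkseq (U g) T) *m ket (s0 g))))) => [|g _].
  rewrite weight_mixture //; last by move=> g s; rewrite /rightmost last_rcons.
  apply: eq_bigr => g _; rewrite sqr_sqrtr // output_probE.
  congr (_ * weight (evolve _ _ _ *m _) _).
  by rewrite -(AT g) mkseq_nth.
rewrite -scalemxAr mulmxA; congr (_ *: (_ *m _)).
by rewrite [LHS]embedM; apply/matrixP => k l; rewrite !mxE -toggleE.
Qed.

End Quantum.

(** * From exact algorithms under every distribution to a bounded-error one *)

Lemma output_prob_exact (R : realType) N (N_gt0 : (0 < N)%N)
    (A : algorithm R N) x (b c : bool) : accept_prob N_gt0 A x = b%:R ->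
  output_prob N_gt0 A x c = (b == c)%:R.
Proof.
rewrite /accept_prob => Ab; have := output_prob_total N_gt0 A x; rewrite Ab.
case: c => [_|/(canRL (addKr _)) ->]; first by rewrite Ab eqb_id.
by case: b {Ab}; rewrite ?oppr0 ?add0r ?addNr.
Qed.

Theorem corollary1 (R : realType) (N : nat) (N_gt0 : (0 < N)%N)
    (D : {set input N}) (D_neq0 : D != set0)
    (f : {x : input N | x \in D} -> bool) :
  (Q2 R N_gt0 f <= max_QSE R N_gt0 f D_neq0)%N.
Proof.
rewrite /Q2 /max_QSE; case: ex_minnP => q _ qmin.
case: ex_maxnP => T /asboolP[mu0 _] Tmax; apply: qmin.
pose computable (g : {ffun input N -> bool}) :=
  `[< exists2 A : algorithm R N, queries A = T &
      forall x, accept_prob N_gt0 A x = (g x)%:R >].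
pose G : finType := {g | computable g}.
pose agree (g : G) (x : {x : input N | x \in D}) : R :=
  (val g (val x) == f x)%:R.
have good (mu : distribution R D) :
    exists g : G, 2%:R / 3%:R <= \sum_x mass mu x * agree g x.
  have : (QSE N_gt0 f mu <= T)%N by apply: Tmax; apply/asboolP; exists mu.
  rewrite /QSE; case: ex_minnP => t /asboolP[A <- [mu_A A01]] _ tT.
  have [B BT BE] := pad_queries N_gt0 tT.
  pose g := [ffun x => accept_prob N_gt0 A x == 1].
  have gE x : accept_prob N_gt0 A x = (g x)%:R.
    by rewrite ffunE; case: (A01 x) => ->; rewrite ?eqxx // eq_sym oner_eq0.
  have g_computable : computable g.
    by apply/asboolP; exists B => // x; rewrite [LHS]BE; exact: gE.
  exists (Sub g g_computable); apply: le_trans mu_A _.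
  rewrite big_mkcond; apply: ler_sum => x _; rewrite gE eqr_nat /agree SubK.
  by case: (g _) (f x) => -[]; rewrite /= ?mulr1 ?mulr0.
have /choice[A AP] (g : G) : exists A : algorithm R N, queries A = T /\
    forall x, accept_prob N_gt0 A x = (val g x)%:R.
  by case: g => g /= /asboolP[A AT AE]; exists A.
have [|p [p0 p1 pf]] := @minimax R _ G agree (2%:R / 3%:R).
  move=> w w0; pose W := \sum_x w x.
  (* The weights in [minimax] are not normalised. Zero weights are met by any [g], and [mu0]
     supplies one; other weights are divided by their total. *)
  have [W0|W_neq0] := eqVneq W 0.
    have [g _] := good mu0; exists g.
    by rewrite !big1 // => x _; rewrite (psumr_eq0P _ W0) ?mul0r.
  have W_gt0 : 0 < W by rewrite lt0r W_neq0 sumr_ge0.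
  have mass0 x : 0 <= w x / W by rewrite divr_ge0 // ltW.
  have mass1 : \sum_x w x / W = 1 by rewrite -mulr_suml divff.
  have [g] := good (Distribution mass0 mass1); exists g.
  rewrite -mulr_suml mulrC -ler_pdivlMr // mulr_suml.
  by under [X in _ <= X]eq_bigr do rewrite mulrAC.
have [B BT BE] := mixture N_gt0 (fun g => (AP g).1) p0 p1.
apply/asboolP; exists B => // x; rewrite /success_prob BE.
rewrite (eq_bigr (fun g => p g * agree g x)) // => g _.
by rewrite (output_prob_exact _ ((AP g).2 _)).
Qed.
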